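(* For every integer $n\ge 2$ and every $A\in\Omega_n$ (the set of $n\times n$ doubly stochastic matrices), with $r^2=\|A-J_n\|_F^2$, $$\frac{\operatorname{per}A}{d_n}\ \ge\ e^{a_n r^2}\qquad\text{and}\qquad \frac{\operatorname{per}\tau_n(A)}{d_n}\ \le\ 1+\beta_n r^2,$$ where $d_n=\dfrac{n!}{n^n}$, $a_n=\dfrac1{2n}+\dfrac1{3n^2}$, and $\beta_n=\dfrac{T_n(1/(n-1))-1}{n-1}$ with $T_n(t)=\displaystyle\sum_{k=0}^n\frac{(nt)^k(1-t)^{n-k}}{k!}$.
   Context: For an $n\times n$ matrix $D=(d_{ij})$, the permanent is $\operatorname{per}D=\sum_{\pi\in S_n}\prod_{i=1}^n d_{i,\pi(i)}$, where $S_n$ is the set of all permutations of $\{1,\dots,n\}$. $\Omega_n$ denotes the set of real $n\times n$ doubly stochastic matrices: all entries are nonnegative and every row sum and every column sum equals $1$. $J_n$ is the $n\times n$ matrix with every entry $1/n$. The Marcus--Minc transform is $\tau_n(A)=(nJ_n-A)/(n-1)$. The Frobenius norm of $X=(x_{ij})$ is $\|X\|_F=\bigl(\sum_{i,j}x_{ij}^2\bigr)^{1/2}$. $T_n$ is a polynomial in the real variable $t$, so zeroth powers are read as $1$ (in particular $0^0=1$). *)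

(* Defs.v *)
From mathcomp Require Import all_boot all_order all_fingroup all_algebra.
From mathcomp Require Import reals sequences exp.

Set Implicit Arguments.
Unset Strict Implicit.
Unset Printing Implicit Defensive.

Import Order.TTheory GRing.Theory Num.Theory.

Local Open Scope ring_scope.

Definition permanent (R : comNzRingType) (n : nat) (D : 'M[R]_n) : R :=
  \sum_(s : 'S_n) \prod_(i < n) D i (s i).

Definition doubly_stochastic (R : numDomainType) (n : nat) (A : 'M[R]_n) : Prop :=
  [/\ forall i j, 0 <= A i j,
      forall i, \sum_(j < n) A i j = 1
    & forall j, \sum_(i < n) A i j = 1].

Definition flat_mx (R : fieldType) (n : nat) : 'M[R]_n := const_mx (n%:R^-1).

Definition marcus_minc (R : fieldType) (n : nat) (A : 'M[R]_n) : 'M[R]_n :=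
  (n%:R - 1)^-1 *: (n%:R *: flat_mx R n - A).

Definition frobenius_norm (R : rcfType) (m n : nat) (X : 'M[R]_(m, n)) : R :=
  Num.sqrt (\sum_(i < m) \sum_(j < n) X i j ^+ 2).

Definition d_ (R : fieldType) (n : nat) : R := n`!%:R / n%:R ^+ n.

Definition a_ (R : fieldType) (n : nat) : R :=
  1 / (2 * n%:R) + 1 / (3 * n%:R ^+ 2).

(* The sum has n + 1 terms.  Since x ^+ 0 = 1 for every x, the k = n term is
   n^n / n! at t = 1, the point at which beta_ evaluates T_ when n = 2. *)
Definition T_ (R : fieldType) (n : nat) (t : R) : R :=
  \sum_(k < n.+1) (n%:R * t) ^+ k * (1 - t) ^+ (n - k) / k`!%:R.

Definition beta_ (R : fieldType) (n : nat) : R :=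
  (T_ n (1 / (n%:R - 1)) - 1) / (n%:R - 1).

(* Main.v *)
(* Lower bound.  Write u = 1/n, and let a be the column of A farthest from J.
   The polynomial p(x) = \prod_i \sum_j A i j * x_j has no zero with all
   real parts positive.  Differentiating it in the variable of a and setting
   that variable to 0 leaves a polynomial q; two applications of the weighted AM-GM
   inequality give q(x) >= \prod_i (1 - a_i)^(1 - a_i) * \prod_j x_j for x > 0.
   Gurvits's argument eliminates the other n - 1 variables: in the variable to
   be eliminated the polynomial has only negative real roots, so AM-GM on these
   roots bounds the derivative at 0 from below, and altogether
   per A >= (n-1)!/(n-1)^(n-1) * \prod_i (1 - a_i)^(1 - a_i).
   A second-order expansion of b ln b at b = 1 - u turns this into
   d_n * exp((1/2 + u/3) * \sum_i (a_i - u)^2), and the sum is at least r^2/n.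

   Upper bound.  n! * per M is the value at M of a form of degree n on symmetric
   tensors.  Expanding it at J + Y over the sets S of tensor factors carrying Y
   gives, for Y = -X/(n-1) with X = A - J, terms which are compared with those
   for Y = (I - J)/(n-1): by Cauchy-Schwarz, by the contractivity of A, and
   because S_n is two-transitive, the former are at most
   r^2/(n-1) times the latter, whose sum is d_n * (T_n(1/(n-1)) - 1). *)
Require Import Defs.
From mathcomp Require Import all_boot all_order all_fingroup all_algebra.
From mathcomp Require Import ring lra.
From mathcomp Require normed_module derive realfun complex.
From mathcomp Require Import reals sequences exp.

Set Implicit Arguments.
Unset Strict Implicit.
Unset Printing Implicit Defensive.

Import Order.TTheory GRing.Theory Num.Theory.

Local Open Scope ring_scope.

(** * Mixed permanents and their pencils *)

Lemma coef1M (T : nzRingType) (p q : {poly T}) :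
  (p * q)`_1 = p`_0 * q`_1 + p`_1 * q`_0.
Proof. by rewrite coefM !big_ord_recl big_ord0 addr0. Qed.

Lemma coef1_prod (T : comNzRingType) (I : finType) (p : I -> {poly T}) :
  (\prod_i p i)`_1 = \sum_i (p i)`_1 * \prod_(j | j != i) (p j)`_0.
Proof.
suff H (s : seq I) : uniq s -> (\prod_(i <- s) p i)`_1 =
    \sum_(i <- s) (p i)`_1 * \prod_(j <- s | j != i) (p j)`_0.
  exact/H/index_enum_uniq.
elim: s => [|a s IH] /=; first by rewrite !big_nil coefC.
case/andP=> aNs us; rewrite !big_cons coef1M IH // eqxx coef0_prod addrC.
congr (_ * _ + _).
  rewrite big_seq [RHS]big_seq_cond; apply: eq_bigl => i.
  by case: eqP => [->|_]; rewrite ?(negPf aNs) ?andbT.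
rewrite big_distrr /= big_seq [RHS]big_seq; apply: eq_bigr => i si.
rewrite big_cons; case: eqP => [ai|_]; first by rewrite ai si in aNs.
by rewrite mulrCA.
Qed.

(** Degree bound and top coefficient of one summand of [pencil]; the size is only bounded because
    some [v i] may vanish. *)
Lemma prod_linear_lead (T : comNzRingType) (I : Type) (P : pred I)
    (w v a : I -> T) (s : seq I) :
  let L := \prod_(i <- s)
    (if P i then (w i)%:P + v i *: 'X else (a i)%:P) in
  (size L <= (count P s).+1)%N /\
  L`_(count P s) = \prod_(i <- s) (if P i then v i else a i).
Proof.
elim: s => [|i s /= [IHs IHc]]; first by rewrite /= !big_nil size_poly1 coefC.
rewrite !big_cons /= -IHc; set L := \prod_(i <- s) _ in IHs IHc *.
case: (P i); last first.
  rewrite add0n mul_polyC coefZ; split => //.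
  exact: leq_trans (size_scale_leq _ _) IHs.
split.
  apply: leq_trans (size_polyMleq _ _) _.
  have : (size ((w i)%:P + v i *: 'X)%R <= 2)%N.
    apply: leq_trans (size_polyD _ _) _; rewrite geq_max.
    rewrite (leq_trans (size_polyC_leq1 _)) //=.
    by rewrite (leq_trans (size_scale_leq _ _)) ?size_polyX.
  by move=> /leq_add /(_ IHs); rewrite -subn1 leq_subLR.
rewrite mulrDl coefD mul_polyC coefZ -scalerAl coefZ coefXM add1n /=.
by rewrite (@nth_default _ _ _ (count P s).+1) // mulr0 add0r.
Qed.

Section Mixed.
Variables (T : comNzRingType) (n : nat).
Implicit Types (A : 'M[T]_n) (w v : 'I_n -> T) (k : nat) (c : 'I_n).

(* [k`!] times the partial derivative of [\prod_i \sum_j A i j * x_j] in the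
   variables of index at least [k], taken where these vanish and where the
   remaining linear forms take the values [w]. *)
Definition mixed A k w : T :=
  permanent (\matrix_(i, j) if (j < k)%N then w i else A i j).

Lemma mixedE A k w :
  mixed A k w =
  \sum_(s : 'S_n) \prod_i (if (s i < k)%N then w i else A i (s i)).
Proof.
by apply: eq_bigr => s _; apply: eq_bigr => i _; rewrite mxE.
Qed.

Lemma eq_mixed A k w v : w =1 v -> mixed A k w = mixed A k v.
Proof.
by move=> wv; rewrite !mixedE; apply: eq_bigr => s _; apply: eq_bigr => i _;
   rewrite wv.
Qed.

Lemma mixed0 A w : mixed A 0 w = permanent A.
Proof. by rewrite mixedE. Qed.

Lemma mixed_full A w : mixed A n w = n`!%:R * \prod_i w i.
Proof.
rewrite mixedE -card_Sn mulr_natl -sumr_const; apply: eq_bigr => s _.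
by apply: eq_bigr => i _; rewrite ltn_ord.
Qed.

Lemma count_perm_lt (s : 'S_n) k : (k <= n)%N ->
  count [pred i | (s i < k)%N] (index_enum 'I_n) = k.
Proof.
move=> kn; rewrite -sum1_count /= (reindex_inj (@perm_inj _ s^-1)) /=.
under eq_bigl do rewrite permKV.
by rewrite -(big_ord_widen n (fun=> 1%N)) // sum1_card card_ord.
Qed.

Lemma mixedZ A k w (a : T) : (k <= n)%N ->
  mixed A k (fun i => a * w i) = a ^+ k * mixed A k w.
Proof.
move=> kn; rewrite !mixedE big_distrr /=; apply: eq_bigr => s _.
rewrite -[X in a ^+ X](count_perm_lt s kn) -iter_mulr_1 -big_const_seq /=.
rewrite [X in X * _]big_mkcond -big_split /=; apply: eq_bigr => i _.
by case: ifP => _; rewrite ?mul1r.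
Qed.

(** The level [c.+1] form along the line through [w] in the direction of column [c]; the
    indeterminate is the variable of that column. *)
Definition pencil A c w : {poly T} :=
  \sum_(s : 'S_n) \prod_i
    (if (s i < c.+1)%N then (w i)%:P + (A i c) *: 'X else (A i (s i))%:P).

Lemma pencil_horner A c w t :
  (pencil A c w).[t] = mixed A c.+1 (fun i => w i + A i c * t).
Proof.
rewrite mixedE horner_sum; apply: eq_bigr => s _; rewrite horner_prod.
by apply: eq_bigr => i _; case: ifP => _; rewrite !hornerE.
Qed.

Lemma pencil_coef0 A c w : (pencil A c w)`_0 = mixed A c.+1 w.
Proof.
rewrite -horner_coef0 pencil_horner; apply: eq_mixed => i.
by rewrite mulr0 addr0.
Qed.

Lemma size_pencil A c w : (size (pencil A c w) <= c.+2)%N.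
Proof.
apply: leq_trans (size_sum _ _ _) _; apply/bigmax_leqP => s _.
have [+ _] := prod_linear_lead [pred i | (s i < c.+1)%N] w (A^~ c)
  (fun i => A i (s i)) (index_enum _).
by rewrite count_perm_lt.
Qed.

Lemma pencil_lead A c w : (pencil A c w)`_c.+1 = mixed A c.+1 (A^~ c).
Proof.
rewrite mixedE coef_sum; apply: eq_bigr => s _.
have [_] := prod_linear_lead [pred i | (s i < c.+1)%N] w (A^~ c)
  (fun i => A i (s i)) (index_enum _).
by rewrite count_perm_lt.
Qed.

(** Differentiating the factor whose row is sent to [l <= c], then swapping [l] with [c], produces
    [mixed A c w]; the [c.+1] choices of [l] contribute equally. *)
Lemma pencil_coef1 A c w : (pencil A c w)`_1 = c.+1%:R * mixed A c w.
Proof.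
rewrite coef_sum; under eq_bigr => s _.
  rewrite coef1_prod (reindex_inj (@perm_inj _ s^-1)) /=; over.
rewrite exchange_big /= mulr_natl -[X in _ *+ X](card_ord c.+1).
rewrite -sumr_const (big_ord_widen n (fun=> mixed A c w)) // [RHS]big_mkcond /=.
apply: eq_bigr => l _; case: ifPn => lc; last first.
  rewrite big1 // => s _; rewrite permKV (negPf lc) coefC /= mul0r //.
rewrite (reindex_inj (mulIg (tperm l c))) mixedE; apply: eq_bigr => s _ /=.
rewrite permKV lc invMg tpermV permM tpermL.
rewrite [RHS](bigD1 (s^-1 c)%g) //= permKV ltnn.
congr (_ * _).
  by rewrite coefD coefC coefZ coefX mulr1 add0r.
apply: eq_bigr => j jc.
have sjc : s j != c by apply: contra jc => /eqP <-; rewrite permK.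
rewrite permM; case: (tpermP l c (s j)) => [sjl|/eqP|_ _].
- have lc' : (l < c)%N.
    by rewrite ltn_neqAle -ltnS lc andbT -sjl.
  by rewrite ltnSn sjl lc' coefD coefC coefZ coefX mulr0 addr0.
- by rewrite (negPf sjc).
rewrite ltnS leq_eqVlt -[(s j == c :> nat)]/(s j == c) (negPf sjc) /=.
by case: ifP => _; rewrite ?coefD ?coefZ ?coefX coefC //= mulr0 addr0.
Qed.

End Mixed.

(** * Stability *)

Lemma coef1_prod_XsubC (F : fieldType) (s : seq F) : 0 \notin s ->
  (\prod_(z <- s) ('X - z%:P))`_1 =
  - (\prod_(z <- s) ('X - z%:P))`_0 * \sum_(z <- s) z^-1.
Proof.
elim: s => [|z s IH]; first by rewrite !big_nil coefC mulr0.
rewrite inE negb_or eq_sym => /andP[z0 /IH {}IH].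
rewrite !big_cons coef1M coef0M IH !coefB !coefX !coefC /=.
by field.
Qed.

Section Stability.
Import complex.
Variable R : rcfType.
Local Open Scope complex_scope.
Implicit Types z w : R[i].

Lemma ReD z w : Re (z + w) = Re z + Re w.
Proof. by case: z w => [a b] [c d]. Qed.

Lemma ReZ (a : R) z : Re (a%:C * z) = a * Re z.
Proof. by case: z => b c; simpc. Qed.

Lemma ReV_lt0 z : Re z < 0 -> Re z^-1 < 0.
Proof.
case: z => a b /= a0; rewrite pmulr_llt0 // invr_gt0.
by rewrite ltr_wpDr ?sqr_ge0 // exprn_even_gt0 //= lt_eqF.
Qed.

Lemma Re_sum_lt0 (s : seq R[i]) : s != [::] ->
  (forall z, z \in s -> Re z < 0) -> Re (\sum_(z <- s) z) < 0.
Proof.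
case: s => // z s _; elim: s z => [|y s IH] z h.
  by rewrite big_seq1 h ?inE.
rewrite big_cons ReD -[ltRHS]addr0 ltrD ?(h z) ?mem_head //.
by apply: IH => u us; apply: h; rewrite inE us orbT.
Qed.

(* The logarithmic derivative of [f] at 0 is the sum of the [- z^-1] over the
   roots [z], each of which has positive real part. *)
Lemma coef1_neq0 (f : {poly R[i]}) : (1 < size f)%N ->
  (forall z, 0 <= Re z -> f.[z] != 0) -> f`_1 != 0.
Proof.
have [s fE] := closed_field_poly_normal f; move=> sf fN0.
have lf : lead_coef f != 0 by rewrite lead_coef_eq0 -size_poly_gt0 ltnW.
have fz z : z \in s -> f.[z] = 0.
  move=> zs; rewrite fE hornerZ horner_prod (big_rem z) //= hornerXsubC.
  by rewrite subrr mul0r mulr0.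
have Re_s z : z \in s -> Re z < 0.
  by move=> /fz fz0; rewrite ltNge; apply/negP => /fN0; rewrite fz0 eqxx.
have s0 : 0 \notin s by apply/negP => /Re_s; rewrite ltxx.
have f0 : f`_0 != 0 by rewrite -horner_coef0 fN0.
have -> : f`_1 = - f`_0 * \sum_(z <- s) z^-1.
  by rewrite fE !coefZ coef1_prod_XsubC //; ring.
rewrite mulf_eq0 oppr_eq0 negb_or f0 /=; apply: contraTneq isT => e.
have : Re (\sum_(z <- [seq u^-1 | u <- s]) z) < 0.
  apply: Re_sum_lt0 => [|z /mapP[u /Re_s u0 ->]]; last exact: ReV_lt0.
  case: (s) fE => // fE; move: sf; rewrite fE big_nil alg_polyC.
  by rewrite ltnNge size_polyC_leq1.
by rewrite big_map e ltxx.
Qed.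

Variables (n : nat) (A : 'M[R]_n).
Hypothesis A_gt0 : forall i j, 0 < A i j.
Let AC := map_mx (real_complex R) A.

Lemma mixed_real k (w : 'I_n -> R) :
  mixed AC k (fun i => (w i)%:C) = (mixed A k w)%:C.
Proof.
rewrite !mixedE rmorph_sum; apply: eq_bigr => s _; rewrite rmorph_prod.
by apply: eq_bigr => i _; rewrite mxE; case: ifP.
Qed.

Lemma mixed_gt0 k (w : 'I_n -> R) : (forall i, 0 < w i) -> 0 < mixed A k w.
Proof.
move=> w0; rewrite mixedE (bigD1 1%g) //= ltr_pwDl //.
  by rewrite prodr_gt0 // => i _; case: ifP.
by rewrite sumr_ge0 // => s _; rewrite prodr_ge0 // => i _; case: ifP => _;
   exact: ltW.
Qed.

(** Descending induction from level [n], where the form is a multiple of the product of the [w i].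
    By induction the pencil has no zero in the closed right half-plane, so [coef1_neq0] makes its
    linear coefficient, a multiple of the form at level [k], nonzero. *)
Lemma mixed_neq0 k (w : 'I_n -> R[i]) : (k <= n)%N ->
  (forall i, 0 < Re (w i)) -> mixed AC k w != 0.
Proof.
move: {2}(n - k)%N (erefl (n - k)%N) => d.
elim: d k w => [|d IH] k w nk kn w0.
  have -> : k = n by apply/eqP; rewrite eqn_leq kn -subn_eq0 nk.
  rewrite mixed_full mulf_neq0 ?pnatr_eq0 -?lt0n ?fact_gt0 //.
  apply/prodf_neq0 => i _; apply/eqP => wi0.
  by have := w0 i; rewrite wi0 ltxx.
have c_lt : (k < n)%N by rewrite -subn_gt0 nk.
pose c := Ordinal c_lt; rewrite -[k]/(val c).
suff : (pencil AC c w)`_1 != 0.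
  by rewrite pencil_coef1; apply: contraNneq => ->; rewrite mulr0.
apply: coef1_neq0 => [|z z0]; last first.
  rewrite pencil_horner; apply: IH => [|//|i]; first by rewrite subnS nk.
  by rewrite mxE ReD ReZ ltr_wpDr // mulr_ge0 // ltW.
(* The pencil is not constant: its coefficient of degree [c.+1] is the form at a column of positive
   reals. *)
rewrite (@leq_trans c.+2) // ltnNge; apply/negP => /leq_sizeP/(_ _ (leqnn _)).
apply/eqP; rewrite pencil_lead.
rewrite (eq_mixed _ _ (v := fun i => (A i c)%:C)) => [|i]; last by rewrite mxE.
rewrite mixed_real; have := @mixed_gt0 c.+1 (A^~ c) (fun i => A_gt0 i c).
by move=> /lt0r_neq0; apply: contra => /eqP/complexI ->.
Qed.

End Stability.

(** * Polynomials with negative real roots *)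

(** AM-GM for [m] factors, the list being padded with zeros through the default value of [nth]. *)
Lemma prod1D_le (R : realFieldType) (m : nat) (s : seq R) :
  (size s <= m)%N -> (forall c, c \in s -> 0 <= c) ->
  \prod_(c <- s) (1 + c) <= (1 + (\sum_(c <- s) c) / m%:R) ^+ m.
Proof.
case: m => [|m] sm s0; first by case: s sm {s0} => // _; rewrite big_nil expr0.
have h i : 0 <= s`_i.
  have [si|si] := ltnP i (size s); first exact/s0/mem_nth.
  by rewrite nth_default.
have [+ _] := leif_AGM (A := 'I_m.+1) (E := fun i : 'I_m.+1 => 1 + s`_i)
  (fun i _ => addr_ge0 ler01 (h i)).
rewrite card_ord big_split /= sumr_const card_ord.
rewrite [(_ + _) / _]mulrDl.
have -> : 1 *+ m.+1 / m.+1%:R = 1 :> R.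
  by rewrite divff // pnatr_eq0.
have -> : \prod_(c <- s) (1 + c) = \prod_(i < m.+1) (1 + s`_i).
  rewrite (big_nth 0) big_mkord (big_ord_widen m.+1 (fun i => 1 + s`_i)) //.
  rewrite big_mkcond; apply: eq_bigr => i _ /=; case: ltnP => // si.
  by rewrite nth_default // addr0.
have -> // : \sum_(c <- s) c = \sum_(i < m.+1) s`_i.
rewrite (big_nth 0) big_mkord (big_ord_widen m.+1 (fun i => s`_i)) //.
rewrite big_mkcond; apply: eq_bigr => i _ /=; case: ltnP => // si.
by rewrite nth_default.
Qed.

Section RealSplit.
Import complex.

(** Taking real parts leaves every complex root unchanged, so the complex factorization descends to
    [R]. *)
Lemma real_split (R : rcfType) (p : {poly R}) :
  (forall z, root (map_poly (real_complex R) p) z ->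
    exists2 r : R, r < 0 & z = r%:C%C) ->
  exists2 s : seq R, p = lead_coef p *: \prod_(r <- s) ('X - r%:P)
    & forall r, r \in s -> r < 0.
Proof.
move=> h; have [-> | p0] := eqVneq p 0.
  by exists [::] => //; rewrite lead_coef0 scale0r.
have [s pE] := closed_field_poly_normal (map_poly (real_complex R) p).
have hs z : z \in s -> exists2 r : R, r < 0 & z = r%:C%C.
  move=> zs; apply: h; rewrite pE rootZ ?lead_coef_eq0 ?map_poly_eq0 //.
  by rewrite root_prod_XsubC.
have sE : s = [seq (complex.Re z)%:C%C | z <- s].
  by rewrite -[LHS]map_id; apply/eq_in_map => z /hs[r _ ->].
exists [seq complex.Re z | z <- s].
  apply: (map_poly_inj (real_complex R)).
  rewrite pE {1}sE map_polyZ lead_coef_map rmorph_prod !big_map; congr (_ *: _).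
  by apply: eq_bigr => z _; rewrite /= map_polyXsubC.
by move=> r /mapP[z /hs[u u0 ->] ->].
Qed.

End RealSplit.

(** Gurvits's univariate inequality. With S = p_1 / p_0, the sum of the -1/r, AM-GM gives p(t) <=
    p_0 (1 + t S / (k+1))^(k+1); this is played against K t <= p(t) at the best [t]. *)
Lemma coef1_ge (R : rcfType) (p : {poly R}) (s : seq R) (k : nat) (K : R) :
  p = lead_coef p *: \prod_(r <- s) ('X - r%:P) ->
  (forall r, r \in s -> r < 0) -> (size p <= k.+2)%N -> (0 < k)%N ->
  0 < p`_0 -> 0 < p`_1 -> (forall t, 0 < t -> K * t <= p.[t]) ->
  K * k%:R ^+ k <= p`_1 * k.+1%:R ^+ k.
Proof.
move=> pE s0 sp k0 p00 p10 hK; set S := \sum_(r <- s) - r^-1.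
have sN0 : 0 \notin s by apply/negP => /s0; rewrite ltxx.
have lp : lead_coef p != 0.
  by apply: contraTneq p00 => l0; rewrite pE l0 scale0r coef0 ltxx.
have p1E : p`_1 = p`_0 * S.
  by rewrite pE !coefZ coef1_prod_XsubC // /S sumrN; ring.
have S0 : 0 < S by rewrite -(pmulr_rgt0 _ p00) -p1E.
have sk : (size s <= k.+1)%N.
  by rewrite -ltnS -(size_prod_XsubC s id) -(size_scale _ lp) -pE.
have pt t : p.[t] = p`_0 * \prod_(c <- [seq - t / r | r <- s]) (1 + c).
  rewrite pE coefZ hornerZ -mulrA; congr (_ * _).
  rewrite -horner_coef0 !horner_prod big_map -big_split /=.
  apply: eq_big_seq => r rs; rewrite !hornerXsubC.
  have r0 : r != 0 by rewrite lt_eqF ?s0.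
  by field.
have kR : 0 < k%:R :> R by rewrite ltr0n.
have kR1 : 0 < k.+1%:R :> R by rewrite ltr0n.
(* Minimiser of (1 + t S / (k+1))^(k+1) / t; there the base of the power equals (k+1)/k. *)
pose t : R := k.+1%:R / (S * k%:R).
have t0 : 0 < t by rewrite divr_gt0 ?mulr_gt0.
have := hK t t0; rewrite pt => /le_trans h.
have {h}: K * t <= p`_0 * (k.+1%:R / k%:R) ^+ k.+1.
  apply: h; rewrite ler_pM2l //; apply: le_trans (prod1D_le (m := k.+1) _ _) _.
  - by rewrite size_map.
  - move=> c /mapP[r /s0 r0 ->]; rewrite mulNr -mulrN mulr_ge0 ?ltW //.
    by rewrite oppr_gt0 invr_lt0.
  rewrite big_map -mulr_sumr mulNr -mulrN -sumrN -/S.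
  suff -> : 1 + t * S / k.+1%:R = k.+1%:R / k%:R by [].
  by rewrite /t -natr1; field; rewrite natr1 !lt0r_neq0.
have F : 0 < S * k%:R * k%:R ^+ k / k.+1%:R.
  by rewrite divr_gt0 ?mulr_gt0 ?exprn_gt0.
rewrite -(ler_pM2r F) => h; rewrite p1E; move: h; congr (_ <= _).
  by rewrite /t; field; rewrite [1 + _]addrC natr1 !lt0r_neq0.
rewrite expr_div_n !exprS; field.
by rewrite [1 + _]addrC natr1 !expf_neq0 ?lt0r_neq0.
Qed.

(** * Elimination of one variable *)

Section Pencil.
Import complex.
Variables (R : rcfType) (n : nat) (A : 'M[R]_n).
Hypothesis A_gt0 : forall i j, 0 < A i j.

Lemma map_pencil (c : 'I_n) (w : 'I_n -> R) :
  map_poly (real_complex R) (pencil A c w) =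
  pencil (map_mx (real_complex R) A) c (fun i => (w i)%:C%C).
Proof.
rewrite rmorph_sum; apply: eq_bigr => s _; rewrite rmorph_prod.
apply: eq_bigr => i _; rewrite !mxE; case: ifP => _ /=; last exact: map_polyC.
by rewrite rmorphD /= map_polyC map_polyZ map_polyX.
Qed.

(* A root [z] outside the negative real axis could be rotated, together with
   [w], into the region where [mixed_neq0] applies. *)
Lemma pencil_root (c : 'I_n) (w : 'I_n -> R) z : (forall i, 0 < w i) ->
  root (map_poly (real_complex R) (pencil A c w)) z ->
  exists2 r : R, r < 0 & z = r%:C%C.
Proof.
move=> w0; rewrite map_pencil rootE pencil_horner => /eqP fz0.
have rot u : 0 < complex.Re u -> complex.Re (u * z) < 0.
  move=> u0; rewrite ltNge; apply/negP => uz0.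
  have := @mixed_neq0 _ _ _ A_gt0 c.+1
    (fun i => u * ((w i)%:C%C + (map_mx (real_complex R) A) i c * z))
    (ltn_ord c).
  rewrite mixedZ // fz0 mulr0 eqxx => H; suff: false by []; apply: H => i.
  rewrite mxE mulrDr ReD mulrCA [u * (w i)%:C%C]mulrC !ReZ.
  by rewrite ltr_wpDr ?mulr_gt0 // mulr_ge0 // ltW.
have := rot 1 ltr01; rewrite mul1r.
case: z {fz0} rot => x y /= rot x0; exists x => //.
have [->//|y0] := eqVneq y 0.
(* This multiplier has positive real part, but its product with z has real part x - (x/y) y = 0. *)
have := rot (1 +i* (x / y))%C ltr01; rewrite /= mul1r divfK // subrr.
by rewrite ltxx.
Qed.

(** The normalisation k^k is the one that keeps [lam] unchanged: the loss (c/(c+1))^c in [coef1_ge],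
    with the factor c+1 of [pencil_coef1], turns (c+1)^(c+1) into c^c. *)
Lemma mixed_step (c : 'I_n) (lam : R) :
  (forall x : 'I_n -> R, (forall i, 0 < x i) ->
    lam * c.+1%:R ^+ c.+1 * \prod_(j < n | (j < c.+1)%N) x j
      <= mixed A c.+1 (fun i => \sum_(j < n | (j < c.+1)%N) A i j * x j)) ->
  forall x : 'I_n -> R, (forall i, 0 < x i) ->
    lam * c%:R ^+ c * \prod_(j < n | (j < c)%N) x j
      <= mixed A c (fun i => \sum_(j < n | (j < c)%N) A i j * x j).
Proof.
move=> h x x0; pose w i := \sum_(j < n | (j < c)%N) A i j * x j; rewrite -/w.
have upd (t : R) : 0 < t ->
    lam * c.+1%:R ^+ c.+1 * (t * \prod_(j < n | (j < c)%N) x j)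
      <= mixed A c.+1 (fun i => w i + A i c * t).
  move=> t0; pose y (j : 'I_n) := if j == c then t else x j.
  have jc (j : 'I_n) : (j < c)%N = (j < c.+1)%N && (j != c).
    by rewrite ltnS ltn_neqAle andbC.
  have yc : y c = t by rewrite /y eqxx.
  have yx (j : 'I_n) : (j < c)%N -> y j = x j.
    by move=> jc'; rewrite /y ifN // neq_ltn jc'.
  have -> : t * \prod_(j < n | (j < c)%N) x j =
      \prod_(j < n | (j < c.+1)%N) y j.
    rewrite [RHS](bigD1 c) //= yc; congr (_ * _); rewrite -(eq_bigl _ _ jc).
    by apply: eq_bigr => j /yx ->.
  rewrite (eq_mixed _ _ 
    (v := fun i => \sum_(j < n | (j < c.+1)%N) A i j * y j)).
    by apply: h => j; rewrite /y; case: ifP.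
  move=> i; rewrite [RHS](bigD1 c) //= yc addrC; congr (_ + _).
  by rewrite -(eq_bigl _ _ jc); apply: eq_bigr => j /yx ->.
have P0 : 0 < \prod_(j < n | (j < c)%N) x j by exact: prodr_gt0.
(* For [c = 0] the forms [w] vanish and [pencil_root] does not apply, but the pencil has degree at
   most 1, so [pencil_lead] gives its linear coefficient. *)
have [c0|c0] := posnP c.
  have := upd 1 ltr01; rewrite mul1r c0 expr1 expr0.
  rewrite (eq_mixed _ _ (v := A^~ c)) => [|i]; last first.
    by rewrite mulr1 /w big_pred0 ?add0r // => j; rewrite c0.
  have := pencil_lead A c (fun=> 0).
  by rewrite c0 pencil_coef1 c0 mul1r !mixed0 => ->.
have w0 i : 0 < w i.
  have j0 : (0 < n)%N by case: (c) => m; case: (n).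
  rewrite /w (bigD1 (Ordinal j0)) //= ltr_pwDl ?mulr_gt0 //.
  by rewrite sumr_ge0 // => j _; rewrite mulr_ge0 // ltW.
have [s pE s0] := real_split (fun z => @pencil_root c w z w0).
have c1 : 0 < c.+1%:R :> R by rewrite ltr0n.
have hK (t : R) : 0 < t ->
  lam * c.+1%:R ^+ c.+1 * (\prod_(j < n | (j < c)%N) x j) * t <=
    (pencil A c w).[t].
  by move=> /upd; rewrite pencil_horner [t * _]mulrC mulrA.
have p0_gt0 : 0 < (pencil A c w)`_0 by rewrite pencil_coef0 mixed_gt0.
have p1_gt0 : 0 < (pencil A c w)`_1 by rewrite pencil_coef1 mulr_gt0 ?mixed_gt0.
have := coef1_ge pE s0 (size_pencil A c w) c0 p0_gt0 p1_gt0 hK.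
rewrite -[X in _ -> is_true X](ler_pM2r (exprn_gt0 c.+1 c1)) pencil_coef1.
have -> : lam * c%:R ^+ c * (\prod_(j < n | (j < c)%N) x j) * c.+1%:R ^+ c.+1 =
    lam * c.+1%:R ^+ c.+1 * (\prod_(j < n | (j < c)%N) x j) * c%:R ^+ c by ring.
suff -> : c.+1%:R * mixed A c w * c.+1%:R ^+ c = mixed A c w * c.+1%:R ^+ c.+1.
  by [].
by rewrite exprS; ring.
Qed.

End Pencil.

(** * Logarithmic inequalities *)

Section Logarithm.
Import derive realfun normed_module.numFieldNormedType.Exports.
Variable R : realType.
Implicit Types (P Q : {poly R}) (x y : R).

Lemma is_derive_ln_sub_frac P Q x : 0 < x -> Q.[x] != 0 ->
  is_derive x 1 (fun y => ln y - P.[y] / Q.[y])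
    (x^-1 - (P^`().[x] * Q.[x] - P.[x] * Q^`().[x]) / Q.[x] ^+ 2).
Proof.
move=> x0 Qx.
have dQ := is_deriveV Qx (is_derive_poly Q x).
have dPQ := is_deriveM (is_derive_poly P x) dQ.
have dln := is_derive1_ln x0.
apply: (is_derive_eq (is_deriveB dln dPQ)).
rewrite /GRing.scale /=.
by field; rewrite Qx gt_eqF.
Qed.

(** The mean value theorem on [1, y]: bounding [ln] by a fraction vanishing at 1 reduces to the sign
    of a rational function. *)
Lemma ln_sub_frac P Q y : 1 <= y -> P.[1] = 0 ->
  (forall x, 1 <= x -> 0 < Q.[x]) ->
  exists2 c, 1 <= c & ln y - P.[y] / Q.[y] =
    (c^-1 - (P^`().[c] * Q.[c] - P.[c] * Q^`().[c]) / Q.[c] ^+ 2) * (y - 1).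
Proof.
move=> y1 P1 Q0.
have df x : 1 <= x -> is_derive x 1 (fun y => ln y - P.[y] / Q.[y])
    (x^-1 - (P^`().[x] * Q.[x] - P.[x] * Q^`().[x]) / Q.[x] ^+ 2).
  move=> x1; apply: is_derive_ln_sub_frac; first exact: lt_le_trans x1.
  by rewrite gt_eqF ?Q0.
have [x| |c] := MVT_segment y1 (f := fun y => ln y - P.[y] / Q.[y])
  (df := fun x => x^-1 - (P^`().[x] * Q.[x] - P.[x] * Q^`().[x]) / Q.[x] ^+ 2).
- by rewrite in_itv /= => /andP[x1 _]; apply/df/ltW.
- apply: derivable_within_continuous => x; rewrite in_itv /= => /andP[x1 _].
  by have [] := df x x1.
rewrite in_itv /= ln1 P1 mul0r !subr0 => /andP[c1 _] ->.
by exists c.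
Qed.

(** With y = e^s this is s <= sinh s. *)
Lemma ln_le_sinh y : 1 <= y -> ln y <= (y ^+ 2 - 1) / (2 * y).
Proof.
move=> y1; have [] := @ln_sub_frac ('X ^+ 2 - 1) (2 *: 'X) y y1.
- by rewrite !hornerE; ring.
- by move=> x x1; rewrite !hornerE; nra.
move=> c c1; rewrite !poly.derivE !hornerE /= -subr_le0 => ->.
have c0 : 0 < c by lra.
rewrite mulr_le0_ge0 ?subr_ge0 //.
rewrite [leLHS](_ : _ = - (c - 1) ^+ 2 / (2 * c ^+ 2)).
  by rewrite mulNr oppr_le0 divr_ge0 ?sqr_ge0 // mulr_ge0 ?sqr_ge0.
by field; lra.
Qed.

(** The left side is the [2/2] Padé approximant of [ln] at 1, so the derivative of the error has the
    factor (c - 1)^4. *)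
Lemma ln_ge_pade y : 1 <= y -> 3 * (y ^+ 2 - 1) / (y ^+ 2 + 4 * y + 1) <= ln y.
Proof.
move=> y1; have [] := 
  @ln_sub_frac (3 *: ('X ^+ 2 - 1)) ('X ^+ 2 + 4 *: 'X + 1) y y1.
- by rewrite !hornerE; ring.
- by move=> x x1; rewrite !hornerE; nra.
move=> c c1; rewrite !poly.derivE !hornerE /= -subr_ge0 => ->.
have c0 : 0 < c by lra.
have Q0 : 0 < c ^+ 2 + 4 * c + 1 by nra.
rewrite mulr_ge0 ?subr_ge0 //.
rewrite -subr_ge0 [leRHS](_ : _ =
    (c - 1) ^+ 4 / (c * (c ^+ 2 + 4 * c + 1) ^+ 2)).
  by rewrite divr_ge0 ?exprn_even_ge0 // mulr_ge0 ?sqr_ge0 // ltW.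
by field; rewrite !lt0r_neq0.
Qed.

End Logarithm.

(** * Expansion of b ln b and weighted AM-GM *)

Section Entropy.
Variable R : realType.
Implicit Types (b v : R).

(** For b <= v, [ln_le_sinh] at v/b leaves the quadratic coefficient 1/(2v); for b >= v,
    [ln_ge_pade] at b/v leaves (2b+v)/(b^2+4bv+v^2). Both are at least 1/2 + (1-v)/3. *)
Lemma xlnx_ge b v : 0 < b <= 1 -> 0 < v < 1 ->
  b * ln v + (b - v) + (1 / 2 + (1 - v) / 3) * (b - v) ^+ 2 <= b * ln b.
Proof.
move=> /andP[b0 b1] /andP[v0 v1].
have sq0 : 0 <= (b - v) ^+ 2 by exact: sqr_ge0.
have [bv|/ltW vb] := leP b v.
  have : 1 <= v / b by rewrite ler_pdivlMr // mul1r.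
  move=> /ln_le_sinh; rewrite ln_div ?posrE //.
  have -> : ((v / b) ^+ 2 - 1) / (2 * (v / b)) =
      (v ^+ 2 - b ^+ 2) / (2 * v * b).
    by field; rewrite !gt_eqF.
  rewrite -(ler_pM2l b0).
  have -> : b * ((v ^+ 2 - b ^+ 2) / (2 * v * b)) =
    (v - b) - (b - v) ^+ 2 * (1 / (2 * v)) by field; rewrite !gt_eqF.
  have : 1 / 2 + (1 - v) / 3 <= 1 / (2 * v) by rewrite ler_pdivlMr; nra.
  by move=> /(ler_wpM2l sq0); lra.
have : 1 <= b / v by rewrite ler_pdivlMr // mul1r.
move=> /ln_ge_pade; rewrite ln_div ?posrE //.
have Q0 : 0 < b ^+ 2 + 4 * b * v + v ^+ 2 by nra.
have -> : 3 * ((b / v) ^+ 2 - 1) / ((b / v) ^+ 2 + 4 * (b / v) + 1) =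
    3 * (b ^+ 2 - v ^+ 2) / (b ^+ 2 + 4 * b * v + v ^+ 2).
  have -> : (b / v) ^+ 2 + 4 * (b / v) + 1 =
      (b ^+ 2 + 4 * b * v + v ^+ 2) / v ^+ 2.
    by field; rewrite gt_eqF.
  by field; rewrite !gt_eqF.
rewrite -(ler_pM2l b0).
have -> : b * (3 * (b ^+ 2 - v ^+ 2) / (b ^+ 2 + 4 * b * v + v ^+ 2)) =
    (b - v) + (b - v) ^+ 2 * ((2 * b + v) / (b ^+ 2 + 4 * b * v + v ^+ 2)).
  by field; rewrite gt_eqF.
have : 1 / 2 + (1 - v) / 3 <= (2 * b + v) / (b ^+ 2 + 4 * b * v + v ^+ 2).
  rewrite ler_pdivlMr //.
  (* The difference is concave in [b], so it is controlled by its values at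
     [b = v] and [b = 1]. *)
  rewrite -subr_ge0.
  have -> : 2 * b + v -
      (1 / 2 + (1 - v) / 3) * (b ^+ 2 + 4 * b * v + v ^+ 2) =
    (1 - b) * (v * (3 - 2 * v)) + (b - v) * ((1 - v) * (7 + 2 * v)) / 6
    + (1 / 2 + (1 - v) / 3) * ((b - v) * (1 - b)) by field.
  by rewrite !addr_ge0 ?divr_ge0 ?mulr_ge0 //; lra.
by move=> /(ler_wpM2l sq0); lra.
Qed.

Lemma ln_prod (I : Type) (s : seq I) (P : pred I) (y : I -> R) :
  (forall i, P i -> 0 < y i) ->
  ln (\prod_(i <- s | P i) y i) = \sum_(i <- s | P i) ln (y i).
Proof.
move=> y0; elim: s => [|i s IH]; first by rewrite !big_nil ln1.
rewrite !big_cons; case: ifP => // Pi.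
by rewrite lnM ?IH // posrE ?y0 ?prodr_gt0.
Qed.

(** Weighted AM-GM: average the tangent bound ln z <= z - 1 at z = y_i / m, where m is the weighted
    mean. *)
Lemma sum_ln_le (I : finType) (P : pred I) (p y : I -> R) :
  (forall i, P i -> 0 <= p i) -> (forall i, P i -> 0 < y i) ->
  \sum_(i | P i) p i = 1 ->
  \sum_(i | P i) p i * ln (y i) <= ln (\sum_(i | P i) p i * y i).
Proof.
move=> p0 y0 p1; set m := \sum_(i | P i) p i * y i.
have m0 : 0 < m.
  rewrite lt_neqAle sumr_ge0 ?andbT => [|i Pi]; last first.
    by rewrite mulr_ge0 ?p0 // ltW ?y0.
  apply/eqP => /esym/psumr_eq0P py0; have /eqP := p1.
  rewrite big1 ?lt_eqF // => i Pi.
  have /eqP := py0 (fun i Pi => mulr_ge0 (p0 i Pi) (ltW (y0 i Pi))) i Pi.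
  by rewrite mulf_eq0 [y i == 0]gt_eqF ?y0 // orbF => /eqP.
have h i : P i -> p i * ln (y i) <= p i * (ln m - 1) + p i * y i / m.
  move=> Pi; have : ln (y i / m) <= y i / m - 1.
    by rewrite -{1}[y i / m](subrKC 1) le_ln1Dx // ltrBrDl subrr divr_gt0 ?y0.
  rewrite ln_div ?posrE ?y0 // => /(ler_wpM2l (p0 i Pi)); lra.
apply: le_trans (ler_sum _ h) _.
by rewrite big_split /= -!mulr_suml p1 -/m divff ?gt_eqF //; lra.
Qed.

End Entropy.

(** * The lower bound *)

(** At level 0 the product is empty and 0^0 = 1, so the bound reads [lam <= permanent A]. *)
Lemma mixed_descent (R : rcfType) (n : nat) (A : 'M[R]_n) (lam : R) (k : nat) :
  (forall i j, 0 < A i j) -> (k <= n)%N ->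
  (forall x : 'I_n -> R, (forall i, 0 < x i) ->
    lam * k%:R ^+ k * \prod_(j < n | (j < k)%N) x j
      <= mixed A k (fun i => \sum_(j < n | (j < k)%N) A i j * x j)) ->
  lam <= permanent A.
Proof.
move=> A0; elim: k => [|k IH] kn h.
  have := h (fun=> 1) (fun=> ltr01).
  by rewrite mixed0 big_pred0 // expr0 !mulr1.
exact: (IH (ltnW kn) (mixed_step A0 (c := Ordinal kn) h)).
Qed.

(** For [c = ord_max] every factor of the pencil is linear, so the pencil is a multiple of a single
    product. *)
Lemma mixed_last (R : numDomainType) (m : nat) (A : 'M[R]_m.+1)
    (w : 'I_m.+1 -> R) :
  mixed A m w = m`!%:R * \sum_i A i ord_max * \prod_(l | l != i) w l.
Proof.
apply: (@mulfI _ m.+1%:R); first by rewrite pnatr_eq0.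
rewrite -(pencil_coef1 A ord_max w) mulrA -natrM -factS.
rewrite (_ : pencil A ord_max w = m.+1`!%:R *:
    \prod_i ((w i)%:P + A i ord_max *: 'X)); last first.
  rewrite -card_Sn scaler_nat -sumr_const; apply: eq_bigr => s _.
  by apply: eq_bigr => i _; rewrite ltn_ord.
rewrite coefZ coef1_prod; congr (_ * _); apply: eq_bigr => i _.
rewrite coefD coefC coefZ coefX mulr1 add0r; congr (_ * _).
by apply: eq_bigr => l _; rewrite coefD coefC coefZ coefX mulr0 addr0.
Qed.

Section Lower.
Variables (R : realType) (m : nat).
Implicit Type A : 'M[R]_m.+1.

Lemma entry_lt1 A i : (0 < m)%N ->
  doubly_stochastic A -> (forall i j, 0 < A i j) -> A i ord_max < 1.
Proof.
move=> m0 [_ rowA _] A0; rewrite -(rowA i) (bigD1 ord_max) //= ltrDl.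
rewrite (bigD1 ord0) /=; last by rewrite -val_eqE /= eq_sym -lt0n.
by rewrite ltr_pwDl // sumr_ge0 // => j _; exact: ltW.
Qed.

(** Write a_i for the last entry of row i. AM-GM over the rows with weights a_i leaves the sum of
    the (1 - a_i) ln w_i; AM-GM inside row i with weights A_ij/(1 - a_i) bounds each term. Unit
    column sums give every x_j exponent 1. *)
Lemma mixed_last_ge A (x : 'I_m.+1 -> R) : (0 < m)%N ->
  doubly_stochastic A -> (forall i j, 0 < A i j) -> (forall i, 0 < x i) ->
  m`!%:R * expR (\sum_i (1 - A i ord_max) * ln (1 - A i ord_max)) *
    \prod_(j < m.+1 | (j < m)%N) x j
  <= mixed A m (fun i => \sum_(j < m.+1 | (j < m)%N) A i j * x j).
Proof.
move=> m0 dsA A0 x0; have [_ rowA colA] := dsA.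
pose w i := \sum_(j < m.+1 | (j < m)%N) A i j * x j.
rewrite -/w mixed_last -mulrA ler_pM2l ?ltr0n ?fact_gt0 //.
have jm (j : 'I_m.+1) : (j < m)%N = (j != ord_max).
  by rewrite ltn_neqAle -ltnS ltn_ord andbT.
have rest i : \sum_(j < m.+1 | (j < m)%N) A i j = 1 - A i ord_max.
  rewrite -(rowA i) [X in X - _](bigD1 ord_max) //=.
  rewrite [A i ord_max + _]addrC addrK.
  exact: eq_bigl.
have a1 i : 0 < 1 - A i ord_max.
  by rewrite subr_gt0; exact: entry_lt1.
have w0 i : 0 < w i.
  rewrite /w (bigD1 ord0) //= ltr_pwDl ?mulr_gt0 //.
  by rewrite sumr_ge0 // => j _; rewrite mulr_ge0 // ltW.
have lnw i : (1 - A i ord_max) * ln (1 - A i ord_max) +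
    \sum_(j < m.+1 | (j < m)%N) A i j * ln (x j)
      <= (1 - A i ord_max) * ln (w i).
  have divE (y : 'I_m.+1 -> R) :
      \sum_(j < m.+1 | (j < m)%N) A i j / (1 - A i ord_max) * y j =
      (\sum_(j < m.+1 | (j < m)%N) A i j * y j) / (1 - A i ord_max).
    by rewrite mulr_suml; apply: eq_bigr => j _; rewrite mulrAC.
  have h : \sum_(j < m.+1 | (j < m)%N) A i j / (1 - A i ord_max) * ln (x j) <=
      ln (\sum_(j < m.+1 | (j < m)%N) A i j / (1 - A i ord_max) * x j).
    apply: sum_ln_le => // [j _|]; first by rewrite divr_ge0 ?ltW.
    by rewrite -mulr_suml rest divff ?gt_eqF.
  move: h; rewrite !divE -/(w i) ln_div ?posrE // ler_pdivrMr //; lra.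
have W0 i : 0 < \prod_(l | l != i) w l by exact: prodr_gt0.
have S0 : 0 < \sum_i A i ord_max * \prod_(l | l != i) w l.
  rewrite (bigD1 ord0) //= ltr_pwDl ?mulr_gt0 //.
  by rewrite sumr_ge0 // => j _; rewrite mulr_ge0 // ltW.
have P0 : 0 < \prod_(j < m.+1 | (j < m)%N) x j by exact: prodr_gt0.
rewrite -ler_ln ?posrE ?mulr_gt0 ?expR_gt0 // lnM ?posrE ?expR_gt0 // expRK.
rewrite ln_prod //.
apply: le_trans (sum_ln_le (fun i _ => ltW (A0 i ord_max)) (fun i _ => W0 i)
  (colA ord_max)).
have -> : \sum_(j < m.+1 | (j < m)%N) ln (x j) =
    \sum_i \sum_(j < m.+1 | (j < m)%N) A i j * ln (x j).
  rewrite exchange_big /=; apply: eq_bigr => j _.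
  by rewrite -mulr_suml colA mul1r.
rewrite -big_split /=; apply: le_trans (ler_sum _ (fun i _ => lnw i)) _.
rewrite le_eqVlt; apply/orP; left; apply/eqP.
have -> : \sum_i A i ord_max * ln (\prod_(l | l != i) w l) =
    \sum_i (A i ord_max * \sum_l ln (w l) - A i ord_max * ln (w i)).
  apply: eq_bigr => i _; rewrite ln_prod // -mulrBr; congr (_ * _).
  by rewrite [X in _ = X - _](bigD1 i) //= [ln (w i) + _]addrC addrK.
rewrite sumrB -mulr_suml colA mul1r -sumrB; apply: eq_bigr => i _; ring.
Qed.

(** Summing [xlnx_ge] over the rows at v = 1 - u, the constant terms give [d_] and the linear terms
    cancel, as the last column sums to 1. *)
Lemma permanent_ge_last A : (0 < m)%N ->
  doubly_stochastic A -> (forall i j, 0 < A i j) ->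
  d_ R m.+1 * expR ((1 / 2 + 1 / (3 * m.+1%:R)) *
    \sum_i (A i ord_max - m.+1%:R^-1) ^+ 2) <= permanent A.
Proof.
move=> m0 dsA A0; have [_ rowA colA] := dsA.
have mR : 0 < m%:R :> R by rewrite ltr0n.
have nR : 0 < m.+1%:R :> R by rewrite ltr0n.
pose u : R := m.+1%:R^-1.
have uE : 1 - u = m%:R / m.+1%:R.
  by rewrite /u -natr1; field; rewrite natr1 gt_eqF.
have a1 i : 0 < 1 - A i ord_max <= 1.
  rewrite subr_gt0 lerBlDr lerDl (ltW (A0 _ _)) andbT.
  exact: entry_lt1.
apply: le_trans (mixed_descent (k := m)
  (lam := m`!%:R * expR (\sum_i (1 - A i ord_max) * ln (1 - A i ord_max))
          / m%:R ^+ m) A0 _ _) => //; last first.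
  move=> x x0; rewrite divfK ?expf_neq0 ?gt_eqF //.
  exact: mixed_last_ge.
(* [d_] is the bound for a flat last column: there the exponents 1 - u add up to m. *)
have -> : d_ R m.+1 = m`!%:R * expR (m%:R * ln (1 - u)) / m%:R ^+ m.
  rewrite /d_ mulrC mulr_natl -mulrC uE expRM_natl lnK ?posrE ?divr_gt0 //.
  rewrite factS natrM exprS expr_div_n; field.
  by rewrite [1 + _]addrC natr1 !expf_neq0 ?gt_eqF.
have AC (p q z t : R) : p * q / z * t = p * (q * t) / z by ring.
rewrite AC -expRD.
rewrite ler_pM2r ?invr_gt0 ?exprn_gt0 // ler_pM2l ?ltr0n ?fact_gt0 // ler_expR.
have v01 : 0 < 1 - u < 1.
  by rewrite uE divr_gt0 //= ltr_pdivrMr // mul1r ltr_nat.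
have h i := xlnx_ge (a1 i) v01.
apply: le_trans _ (ler_sum _ (fun i _ => h i)).
rewrite !big_split /= -mulr_suml -mulr_sumr !sumrB colA !sumr_const card_ord.
have -> : 1 *+ m.+1 - 1 = m%:R :> R by rewrite -natr1; ring.
have -> : m.+1%:R + \sum_i - A i ord_max + - (1 - u) *+ m.+1 = 0 :> R.
  rewrite sumrN colA -[- (1 - u) *+ _]mulr_natr mulNr mulrBl.
  by rewrite mulVf ?gt_eqF // mul1r; ring.
rewrite addr0 lerD2l.
have -> : 1 / 2 + (1 - (1 - u)) / 3 = 1 / 2 + 1 / (3 * m.+1%:R) :> R.
  by rewrite /u; field; rewrite [1 + _]addrC natr1 gt_eqF.
rewrite le_eqVlt; apply/orP; left; apply/eqP; congr (_ * _).
by apply: eq_bigr => i _; rewrite /u; ring.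
Qed.

End Lower.

(** * From positive matrices to all doubly stochastic ones *)

Lemma poly_ge0_at0 (R : realFieldType) (p : {poly R}) :
  (forall e, 0 < e <= 1 -> 0 <= p.[e]) -> 0 <= p.[0].
Proof.
move=> p_ge0; rewrite leNgt; apply/negP => p0.
have [|q pE] := factor_theorem (p - p.[0]%:P) 0 _.
  by rewrite rootE !hornerE subrr.
have [M qM] := poly_itv_bound q 0 1.
have M0 : 0 <= M by rewrite (le_trans (normr_ge0 _) (qM 0 _)) ?lexx ?ler01.
(* Small enough that e <= 1 and M e < -p(0), so that p(e) would be negative. *)
pose e := - p.[0] / (M + 1 - p.[0]).
have D0 : 0 < M + 1 - p.[0] by lra.
have e0 : 0 < e by rewrite divr_gt0 ?oppr_gt0.
have e1 : e <= 1 by rewrite ler_pdivrMr //; lra.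
have := p_ge0 e; rewrite e0 e1 => /(_ isT).
have -> : p = q * 'X + p.[0]%:P by rewrite -[p in LHS](subrK p.[0]%:P) pE subr0.
rewrite hornerD hornerMX hornerC.
have := le_trans (ler_norm _) (qM e _); rewrite ltW ?e1 // => /(_ isT).
move=> /(ler_wpM2r (ltW e0)) qe.
have : M * e < - p.[0] by rewrite /e mulrA ltr_pdivrMr //; nra.
lra.
Qed.

Lemma permanent_xcol (R : comNzRingType) (n : nat) (j1 j2 : 'I_n)
    (A : 'M[R]_n) :
  permanent (xcol j1 j2 A) = permanent A.
Proof.
rewrite /permanent [RHS](reindex_inj (mulIg (tperm j1 j2))) /=.
by apply: eq_bigr => s _; apply: eq_bigr => i _; rewrite mxE permM.
Qed.

Section Lower.
Variables (R : realType) (m : nat).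
Implicit Type A : 'M[R]_m.+1.

Lemma doubly_stochastic_xcol A j1 j2 :
  doubly_stochastic A -> doubly_stochastic (xcol j1 j2 A).
Proof.
case=> A0 rowA colA; split=> [i j|i|j].
- by rewrite mxE.
- rewrite -(rowA i) [RHS](reindex_inj (@perm_inj _ (tperm j1 j2))) /=.
  by apply: eq_bigr => j _; rewrite mxE.
by rewrite -(colA (tperm j1 j2 j)); apply: eq_bigr => i _; rewrite mxE.
Qed.

(** Some column carries at least the average S/n of the squared distance; it is swapped into last
    place, and (1/2 + 1/(3n))/n is [a_]. *)
Lemma permanent_ge_pos A : (0 < m)%N ->
  doubly_stochastic A -> (forall i j, 0 < A i j) ->
  d_ R m.+1 * expR (a_ R m.+1 * \sum_i \sum_j (A i j - m.+1%:R^-1) ^+ 2)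
    <= permanent A.
Proof.
move=> m0 dsA A0; set S := \sum_i _.
have nR : 0 < m.+1%:R :> R by rewrite ltr0n.
have [j0 j0P] : exists j, S / m.+1%:R <= \sum_i (A i j - m.+1%:R^-1) ^+ 2.
  apply/existsP; rewrite -[X in is_true X]negbK negb_exists; apply/negP.
  move=> /forallP h; have : S < S; last by rewrite ltxx.
  rewrite {1}/S exchange_big /=.
  apply: (@lt_le_trans _ _ (\sum_(j < m.+1) S / m.+1%:R)); last first.
    by rewrite sumr_const card_ord -[leLHS]mulr_natr divfK ?gt_eqF.
  apply: ltr_sum => [|j _]; last by rewrite ltNge.
  by apply/hasP; exists ord0; rewrite ?mem_index_enum.
have := permanent_ge_last m0 (doubly_stochastic_xcol j0 ord_max dsA).
rewrite permanent_xcol => H; apply: le_trans (H _) => [|i j].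
  2: by rewrite mxE.
rewrite ler_pM2l ?divr_gt0 ?exprn_gt0 ?ltr0n ?fact_gt0 // ler_expR.
under [in leRHS]eq_bigr do rewrite mxE tpermR.
have -> : a_ R m.+1 * S = (1 / 2 + 1 / (3 * m.+1%:R)) * (S / m.+1%:R).
  by rewrite /a_; field; rewrite [1 + _]addrC natr1 gt_eqF.
by rewrite ler_pM2l // addr_gt0 // divr_gt0 ?mulr_gt0.
Qed.

(* Mixing with [J] makes [A] positive; both sides are compared as the mixing
   parameter tends to 0. *)
Lemma permanent_ge A : (0 < m)%N -> doubly_stochastic A ->
  d_ R m.+1 * expR (a_ R m.+1 * \sum_i \sum_j (A i j - m.+1%:R^-1) ^+ 2)
    <= permanent A.
Proof.
move=> m0 [A0 rowA colA]; set S := \sum_i _; set u : R := m.+1%:R^-1.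
have nR : 0 < m.+1%:R :> R by rewrite ltr0n.
have u0 : 0 < u by rewrite invr_gt0.
have S0 : 0 <= S.
  by rewrite sumr_ge0 // => i _; rewrite sumr_ge0 // => j _; rewrite sqr_ge0.
have a0 : 0 <= a_ R m.+1.
  by rewrite addr_ge0 ?divr_ge0 ?mulr_ge0 ?exprn_ge0 // ltW.
have d0 : 0 < d_ R m.+1 by rewrite divr_gt0 ?exprn_gt0 ?ltr0n ?fact_gt0.
pose P : {poly R} :=
  permanent (\matrix_(i, j) ((A i j)%:P + (u - A i j) *: 'X)).
have PE e : P.[e] = permanent (\matrix_(i, j) (A i j + (u - A i j) * e)).
  rewrite horner_sum; apply: eq_bigr => s _; rewrite horner_prod.
  by apply: eq_bigr => i _; rewrite !mxE !hornerE.
pose c := d_ R m.+1 * expR (a_ R m.+1 * S).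
have c0 : 0 < c by rewrite mulr_gt0 ?expR_gt0.
(* With t = [a_ R m.+1 * S], the bound exp(t (1-e)^2) is not polynomial in e; its minorant exp(t) (1
   - 2 t e), equal to it at e = 0, is. *)
have := @poly_ge0_at0 _ (P - c *: (1 - (2 * a_ R m.+1 * S) *: 'X)).
rewrite !hornerE PE.
have -> : \matrix_(i, j) (A i j + (u - A i j) * 0) = A.
  by apply/matrixP => i j; rewrite mxE mulr0 addr0.
rewrite ?mulr0 ?subr0 ?mulr1 subr_ge0; apply => e /andP[e0 e1].
rewrite !hornerE PE; set Ae := \matrix_(i, j) _.
have dsAe : doubly_stochastic Ae.
  have su : \sum_(k < m.+1) u = 1.
    by rewrite sumr_const card_ord -[LHS]mulr_natr mulVf ?gt_eqF.
  split=> [i j|i|j].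
  - rewrite mxE; have := A0 i j; nra.
  - rewrite (eq_bigr _ (fun j _ => mxE _ _ i j)) big_split /= -mulr_suml sumrB.
    by rewrite su rowA subrr mul0r addr0.
  rewrite (eq_bigr _ (fun i _ => mxE _ _ i j)) big_split /= -mulr_suml sumrB.
  by rewrite su colA subrr mul0r addr0.
have Ae0 i j : 0 < Ae i j.
  rewrite mxE; have := A0 i j; nra.
rewrite subr_ge0; apply: le_trans (permanent_ge_pos m0 dsAe Ae0).
have -> : \sum_i \sum_j (Ae i j - m.+1%:R^-1) ^+ 2 = (1 - e) ^+ 2 * S.
  rewrite /S mulr_sumr; apply: eq_bigr => i _.
  by rewrite mulr_sumr; apply: eq_bigr => j _; rewrite mxE -/u; ring.
rewrite /c -[d_ R m.+1 * _ * _]mulrA ler_pM2l //.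
set t := a_ R m.+1 * S; have t0 : 0 <= t by exact: mulr_ge0.
apply: (@le_trans _ _ (expR t * expR (- (2 * t * e)))).
  rewrite ler_pM2l ?expR_gt0 //; apply: le_trans (expR_ge1Dx _).
  by rewrite /t; lra.
rewrite -expRD ler_expR [leRHS](_ : _ = t - 2 * t * e + t * e ^+ 2).
  by rewrite lerDl mulr_ge0 ?sqr_ge0.
by rewrite /t; ring.
Qed.

End Lower.

(** * Permanents as forms on symmetric tensors *)

(** The variance of [F] under the weights [k] is nonnegative. *)
Lemma sqr_mean_le (R : realFieldType) (I : finType) (k F : I -> R) :
  (forall i, 0 <= k i) -> \sum_i k i = 1 ->
  (\sum_i k i * F i) ^+ 2 <= \sum_i k i * F i ^+ 2.
Proof.
move=> k0 k1; set mu := \sum_i _.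
have : 0 <= \sum_i k i * (F i - mu) ^+ 2.
  by rewrite sumr_ge0 // => i _; rewrite mulr_ge0 ?sqr_ge0.
have -> : \sum_i k i * (F i - mu) ^+ 2 =
    \sum_i (k i * F i ^+ 2 - (k i * F i) * (2 * mu) + k i * mu ^+ 2).
  by apply: eq_bigr => i _; ring.
rewrite big_split sumrB /= -!mulr_suml k1 -/mu.
by lra.
Qed.

Section Tensor.
Variables (R : realFieldType) (n : nat).
Local Notation index := {ffun 'I_n -> 'I_n}.
Implicit Types (B C : 'I_n -> 'M[R]_n) (f g h : index) (M : 'M[R]_n).

(** An entry of the tensor product of the [B p], multi-indices being the basis of the n-th tensor
    power. *)
Definition kron B f g : R := \prod_p B p (f p) (g p).

(* The symmetric tensor of the polynomial [\prod_i z_i]. *)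
Definition alltensor f : R := (injectiveb f)%:R.

Definition tapp B f : R := \sum_g kron B f g * alltensor g.

(** Multilinear in the [B p]; on equal arguments it is n! times the permanent, by [tform_const]. *)
Definition tform B : R := \sum_f alltensor f * tapp B f.

Lemma eq_tform B C : B =1 C -> tform B = tform C.
Proof.
move=> BC; apply: eq_bigr => f _; congr (_ * _); apply: eq_bigr => g _.
by congr (_ * _); apply: eq_bigr => p _; rewrite BC.
Qed.

Lemma kron_mul B C f h :
  \sum_g kron B f g * kron C g h = kron (fun p => B p *m C p) f h.
Proof.
rewrite /kron; under [RHS]eq_bigr do rewrite mxE.
by rewrite bigA_distr_bigA; apply: eq_bigr => g _; rewrite big_split.
Qed.

Lemma kron_tapp B C f :
  \sum_g kron B f g * tapp C g = tapp (fun p => B p *m C p) f.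
Proof.
rewrite /tapp; under [LHS]eq_bigr do rewrite mulr_sumr.
rewrite exchange_big; apply: eq_bigr => h _ /=.
by rewrite -kron_mul mulr_suml; apply: eq_bigr => g _; rewrite mulrA.
Qed.

Lemma kron_tr B f g : kron (fun p => (B p)^T) f g = kron B g f.
Proof. by apply: eq_bigr => p _; rewrite mxE. Qed.

Lemma dot_tapp B C :
  \sum_f tapp B f * tapp C f = tform (fun p => (B p)^T *m C p).
Proof.
rewrite /tform; under [RHS]eq_bigr => g _.
  rewrite -kron_tapp mulr_sumr; over.
rewrite exchange_big; apply: eq_bigr => f _ /=; rewrite mulr_suml.
by apply: eq_bigr => g _; rewrite kron_tr mulrA [alltensor g * _]mulrC.
Qed.

Lemma kron_row_sum B f : (forall p i, \sum_j B p i j = 1) ->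
  \sum_g kron B f g = 1.
Proof.
move=> B1; rewrite /kron -(bigA_distr_bigA (fun p j => B p (f p) j)).
by rewrite big1.
Qed.

(** A tensor product of doubly stochastic matrices is doubly stochastic: row sums allow
    [sqr_mean_le], column sums then collapse the double sum. *)
Lemma kron_contract B F : (forall p, doubly_stochastic (B p)) ->
  \sum_f (\sum_g kron B f g * F g) ^+ 2 <= \sum_g F g ^+ 2.
Proof.
move=> dsB; apply: (@le_trans _ _ (\sum_f \sum_g kron B f g * F g ^+ 2)).
  apply: ler_sum => f _; apply: sqr_mean_le => [g|].
    by rewrite prodr_ge0 // => p _; have [] := dsB p.
  by apply: kron_row_sum => p i; have [] := dsB p.
rewrite exchange_big /= le_eqVlt; apply/orP; left; apply/eqP.
apply: eq_bigr => g _; rewrite -mulr_suml.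
under eq_bigr do rewrite -kron_tr; rewrite kron_row_sum ?mul1r // => p i.
by under eq_bigr do rewrite mxE; have [] := dsB p.
Qed.

Lemma sum_alltensor (F : index -> R) :
  \sum_f alltensor f * F f = \sum_(s : 'S_n) F (val s).
Proof.
rewrite /alltensor (bigID (fun f => injectiveb f)) /= [X in _ + X]big1 ?addr0.
  rewrite (reindex_onto (fun s : 'S_n => val s)
    (insubd (1%g : {perm 'I_n}))) /=.
    apply: eq_big => [s|s /andP[+ _]]; last by move=> ->; rewrite mul1r.
    by rewrite valKd eqxx andbT; exact: (valP s).
  by move=> f fi; exact: insubdK.
by move=> f /negPf ->; rewrite mul0r.
Qed.

(** Only permutations contribute on both sides; relabelling the factors by the first one turns each
    inner sum into a permanent. *)
Lemma tform_const M : tform (fun=> M) = n`!%:R * permanent M.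
Proof.
rewrite /tform sum_alltensor -card_Sn mulr_natl -sumr_const.
apply: eq_bigr => s _; rewrite /tapp.
under eq_bigr do rewrite mulrC; rewrite sum_alltensor.
rewrite (reindex_inj (mulgI s)) /=; apply: eq_bigr => t _.
rewrite [RHS](reindex_inj (@perm_inj _ s)); apply: eq_bigr => p _.
by rewrite !pvalE permM.
Qed.

Let perm_index (pi : 'S_n) f : index := [ffun p => pi (f p)].

Let reindex_perm (pi : 'S_n) (F : index -> R) :
  \sum_f F (perm_index pi f) = \sum_f F f.
Proof.
rewrite [RHS](reindex (perm_index pi)) //.
exists (perm_index pi^-1%g) => f _; apply/ffunP => p;
  by rewrite !ffunE ?permK ?permKV.
Qed.

Let alltensor_perm (pi : 'S_n) f : alltensor (perm_index pi f) = alltensor f.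
Proof.
congr (nat_of_bool _)%:R; apply/injectiveP/injectiveP => fi p q.
  by move=> fpq; apply: fi; rewrite !ffunE fpq.
by rewrite !ffunE => /perm_inj/fi.
Qed.

Lemma tform_sym (pi pi' : 'S_n) B :
  tform (fun p => \matrix_(i, j) B p (pi i) (pi' j)) = tform B.
Proof.
rewrite /tform -[RHS](reindex_perm pi); apply: eq_bigr => f _.
rewrite alltensor_perm; congr (_ * _).
rewrite /tapp -[RHS](reindex_perm pi'); apply: eq_bigr => g _.
rewrite alltensor_perm; congr (_ * _); apply: eq_bigr => p _.
by rewrite mxE !ffunE.
Qed.

Definition set_leg B p M : 'I_n -> 'M[R]_n :=
  fun l => if l == p then M else B l.

Lemma tform_leg B p M :
  tform (set_leg B p M) =
  \sum_i \sum_j M i j * tform (set_leg B p (delta_mx i j)).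
Proof.
pose rest f g := \prod_(l | l != p) B l (f l) (g l).
have kE N f g : kron (set_leg B p N) f g = N (f p) (g p) * rest f g.
  rewrite /kron (bigD1 p) //= /set_leg eqxx; congr (_ * _).
  by apply: eq_bigr => l /negPf ->.
have tE N : tform (set_leg B p N) =
    \sum_(f : index) \sum_(g : index) 
      N (f p) (g p) * (alltensor f * rest f g * alltensor g).
  apply: eq_bigr => f _; rewrite mulr_sumr; apply: eq_bigr => g _.
  by rewrite kE; ring.
rewrite tE; under [RHS]eq_bigr => i _.
  under eq_bigr => j _.
    rewrite tE mulr_sumr; under eq_bigr => f _ do rewrite mulr_sumr.
    over.
  over.
rewrite /=.
transitivity (\sum_i \sum_(f : index) \sum_j \sum_(g : index) M i j *
    (delta_mx i j (f p) (g p) * (alltensor f * rest f g * alltensor g))).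
  rewrite [RHS]exchange_big; apply: eq_bigr => f _ /=.
  rewrite [RHS](bigD1 (f p)) //= [X in _ = _ + X]big1 => [|i ip]; last first.
    rewrite big1 // => j _; rewrite big1 // => g _.
    by rewrite mxE [f p == i]eq_sym (negPf ip) mul0r mulr0.
  rewrite addr0 [RHS]exchange_big; apply: eq_bigr => g _ /=.
  rewrite [RHS](bigD1 (g p)) //= [X in _ = _ + X]big1 => [|j jp]; last first.
    by rewrite mxE eqxx [g p == j]eq_sym (negPf jp) mul0r mulr0.
  by rewrite mxE !eqxx mul1r addr0.
by apply: eq_bigr => i _; rewrite exchange_big.
Qed.

Lemma tform_delta_sym B p (pi pi' : 'S_n) i j :
  (forall l, l != p -> forall a b, B l (pi a) (pi' b) = B l a b) ->
  tform (set_leg B p (delta_mx (pi i) (pi' j))) =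
  tform (set_leg B p (delta_mx i j)).
Proof.
move=> Bsym; rewrite -(tform_sym pi pi'); apply: eq_tform => l.
apply/matrixP => a b; rewrite !mxE /set_leg; case: eqVneq => [_|/Bsym -> //].
by rewrite !mxE !(inj_eq perm_inj).
Qed.

End Tensor.

(** * Comparison of the terms of the expansion *)

Section Mix.
Variables (R : realFieldType) (m : nat).
Local Notation n := m.+2.
Implicit Types (B : 'I_n -> 'M[R]_n) (M X Y A : 'M[R]_n) (S : {set 'I_n}).
Local Notation J := (flat_mx R n).
Local Notation P := (1%:M - J).

(* By two-transitivity of the symmetric group the coefficients of this linear
   form in [M] only depend on whether the position is diagonal. *)
Lemma tform_trace B p :
  (forall l, l != p -> forall (pi : 'S_n) a b, B l (pi a) (pi b) = B l a b) ->
  exists k, forall M, (forall i, \sum_j M i j = 0) ->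
    tform (set_leg B p M) = k * \tr M.
Proof.
move=> Bsym; pose q i j := tform (set_leg B p (delta_mx i j)).
have qs (pi : 'S_n) i j : q (pi i) (pi j) = q i j.
  by apply: tform_delta_sym => l lp a b; exact: Bsym.
pose i1 : 'I_n := lift ord0 ord0.
have qii i : q i i = q ord0 ord0.
  by rewrite -(qs (tperm ord0 i) ord0 ord0) tpermL.
have qij i j : i != j -> q i j = q ord0 i1.
  (* [s] sends 0 to i; then [t] fixes i and sends the image of 1 to j. *)
  move=> ij; pose s := tperm ord0 i; pose t := tperm (s i1) j.
  have s0 : s ord0 = i by rewrite tpermL.
  have s1i : s i1 != i by rewrite -s0 (inj_eq perm_inj).
  have ti : t i = i by rewrite tpermD // eq_sym.
  have tj : t (s i1) = j by rewrite tpermL.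
  by rewrite -(qs (s * t)%g ord0 i1) !permM s0 ti tj.
(* Zero row sums make the off-diagonal part of row i equal to [- M i i]. *)
exists (q ord0 ord0 - q ord0 i1) => M M0; rewrite tform_leg /mxtrace mulr_sumr.
apply: eq_bigr => i _; rewrite -/(q _ _) (bigD1 i) //= -/(q i i) qii.
rewrite (eq_bigr (fun j => M i j * q ord0 i1)) => [|j ji]; last first.
  by rewrite -/(q i j) qij // eq_sym.
have := M0 i; rewrite (bigD1 i) //= -mulr_suml => /eqP.
by rewrite addr_eq0 => /eqP ->; ring.
Qed.

(** [J] is invariant under independent row and column permutations, so all coefficients of the
    linear form agree. *)
Lemma tform_flat_leg p M : \sum_i \sum_j M i j = 0 ->
  tform (set_leg (fun=> J) p M) = 0.
Proof.
move=> M0; rewrite tform_leg.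
have q i j : tform (set_leg (fun=> J) p (delta_mx i j)) =
    tform (set_leg (fun=> J) p (delta_mx ord0 ord0)).
  rewrite -(tpermL ord0 i) -[X in delta_mx _ X](tpermL ord0 j).
  by rewrite tform_delta_sym // => l _ a b; rewrite !mxE.
under eq_bigr do under eq_bigr do rewrite q.
by under eq_bigr do rewrite -mulr_suml; rewrite -mulr_suml M0 mul0r.
Qed.

Definition mix S Y : 'I_n -> 'M[R]_n := fun l => if l \in S then Y else J.

Let nR : n%:R != 0 :> R. Proof. by rewrite pnatr_eq0. Qed.

Lemma mul_flat M i j : (M *m J) i j = (\sum_k M i k) / n%:R.
Proof. by rewrite mxE mulr_suml; apply: eq_bigr => k _; rewrite mxE. Qed.

Lemma flat_mul M i j : (J *m M) i j = (\sum_k M k j) / n%:R.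
Proof. by rewrite mxE mulr_suml; apply: eq_bigr => k _; rewrite mxE mulrC. Qed.

Lemma flat_flat : J *m J = J.
Proof.
apply/matrixP => i j; rewrite mul_flat mxE.
under eq_bigr do rewrite mxE.
by rewrite sumr_const card_ord -[X in X / _]mulr_natr mulVf // mul1r.
Qed.

Lemma flat_tr : J^T = J.
Proof. exact: trmx_const. Qed.

Lemma trace_mul_tr X : \tr (X *m X^T) = \sum_i \sum_j X i j ^+ 2.
Proof.
apply: eq_bigr => i _; rewrite mxE; apply: eq_bigr => j _.
by rewrite mxE expr2.
Qed.

Lemma trace_proj : \tr P = m.+1%:R.
Proof.
rewrite linearB /= mxtrace1 /mxtrace.
under eq_bigr do rewrite mxE.
by rewrite sumr_const card_ord -[X in _ - X]mulr_natr mulVf // -natr1 addrK.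
Qed.

Lemma mix_sym S (pi : 'S_n) l a b : mix S P l (pi a) (pi b) = mix S P l a b.
Proof. by rewrite /mix; case: ifP => _; rewrite !mxE ?(inj_eq perm_inj). Qed.

(** The form is split as an inner product of two tensors, each of squared norm at most the
    right-hand side: the first keeps [X] in leg [p] only, the second becomes a tensor with [X] in a
    single leg [q] once the contraction [A] is removed from the others. *)
Lemma tform_mix_le A X S : doubly_stochastic A -> X = A - J -> S != set0 ->
  `|tform (mix S X)| <=
    (\sum_i \sum_j X i j ^+ 2) / m.+1%:R * tform (mix S P).
Proof.
move=> dsA XE S0; set r2 := \sum_i _; have [A0 rowA colA] := dsA.
have AJ : A *m J = J.
  by apply/matrixP => i j; rewrite mul_flat rowA mxE mul1r.
have JA : J *m A = J.
  by apply/matrixP => i j; rewrite flat_mul colA mxE mul1r.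
have XJ : X *m J = 0 by rewrite XE mulmxBl AJ flat_flat subrr.
have JX : J *m X = 0 by rewrite XE mulmxBr JA flat_flat subrr.
have PJ : P *m J = 0 by rewrite mulmxBl mul1mx flat_flat subrr.
have XP : X *m P = X by rewrite mulmxBr mulmx1 XJ subr0.
have PX : P *m X = X by rewrite mulmxBl mul1mx JX subr0.
have PP : P *m P = P by rewrite mulmxBr mulmx1 PJ subr0.
have AP : A *m P = X by rewrite XE mulmxBr mulmx1 AJ.
have PT : P^T = P by rewrite linearB /= trmx1 flat_tr.
have row0 M : M *m J = 0 -> forall i, \sum_j M i j = 0.
  move=> MJ i; have /matrixP/(_ i i)/eqP := MJ.
  by rewrite mul_flat mxE mulf_eq0 invr_eq0 (negPf nR) orbF => /eqP.
have [p pS] := set0Pn _ S0.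
have mixE Y : mix S Y =1 set_leg (mix S Y) p Y.
  by move=> l; rewrite /set_leg; case: eqP => // ->; rewrite /mix pS.
(* With only one leg off [J], both forms vanish. *)
have [q qS | Sp] := pickP (mem (S :\ p)); last first.
  have SE : S = [set p].
    apply/setP => l; have := Sp l; rewrite !inE.
    by case: eqP => [-> _|_ /=] //; rewrite pS.
  have mixF Y : mix S Y =1 set_leg (fun=> J) p Y.
    by move=> l; rewrite /mix /set_leg SE inE.
  rewrite (eq_tform (mixF X)) (eq_tform (mixF P)).
  rewrite !tform_flat_leg ?normr0 ?mulr0 //.
    by rewrite big1 // => i _; exact: row0.
  by rewrite big1 // => i _; exact: row0.
move: qS; rewrite /= !inE => /andP[qp qS].
(* By [tform_trace], replacing [P] by [Z] in one leg multiplies the form by \tr Z / \tr P. *)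
have legr t Z : t \in S -> Z *m J = 0 -> \tr Z = r2 ->
    tform (set_leg (mix S P) t Z) = r2 / m.+1%:R * tform (mix S P).
  move=> tS ZJ Zr.
  have [k kE] := @tform_trace (mix S P) t (fun l _ => mix_sym S ^~ l).
  rewrite kE; last exact: row0.
  have -> : tform (mix S P) = tform (set_leg (mix S P) t P).
    apply: eq_tform => l; rewrite /set_leg; case: eqP => // ->.
    by rewrite /mix tS.
  rewrite kE; last exact: row0.
  by rewrite Zr trace_proj; field; rewrite [1 + _]addrC natr1 pnatr_eq0.
(* In the inner product leg [p] becomes X P = X, and the other legs of [S] become P X = X. *)
pose C1 l : 'M[R]_n := if l == p then X^T else mix S P l.
pose C2 l : 'M[R]_n := if l == p then P else mix S X l.
pose C3 l : 'M[R]_n := if l == q then X else mix S P l.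
have -> : tform (mix S X) = \sum_f tapp C1 f * tapp C2 f.
  rewrite dot_tapp; apply: eq_tform => l; rewrite /C1 /C2 /mix.
  case: eqP => [->|_]; first by rewrite trmxK XP pS.
  by case: ifP => _; rewrite ?PT ?PX // flat_tr flat_flat.
have h1 : \sum_f tapp C1 f ^+ 2 = r2 / m.+1%:R * tform (mix S P).
  rewrite -(legr p (X *m X^T)) //; last exact: trace_mul_tr.
    under eq_bigr do rewrite expr2.
    rewrite dot_tapp; apply: eq_tform => l; rewrite /C1 /set_leg /mix.
    case: eqP => _; first by rewrite trmxK.
    by case: ifP => _; rewrite ?PT ?PP // flat_tr flat_flat.
  by rewrite -mulmxA -flat_tr -trmx_mul JX trmx0 mulmx0.
have h2 : \sum_f tapp C2 f ^+ 2 <= r2 / m.+1%:R * tform (mix S P).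
  rewrite -(legr q (X^T *m X)) //; first last.
  - by rewrite mxtrace_mulC trace_mul_tr.
  - by rewrite -mulmxA XJ mulmx0.
  have <- : \sum_f tapp C3 f ^+ 2 = tform (set_leg (mix S P) q (X^T *m X)).
    under eq_bigr do rewrite expr2.
    rewrite dot_tapp; apply: eq_tform => l; rewrite /C3 /set_leg /mix.
    case: eqP => _ //.
    by case: ifP => _; rewrite ?PT ?PP // flat_tr flat_flat.
  (* Since X = A P, the tensor of [C2] is the image under [D] of the tensor of [C3]. *)
  pose D l : 'M[R]_n := if l \in S :\ p :\ q then A else 1%:M.
  have ds1 : doubly_stochastic (1%:M : 'M[R]_n).
    split=> [i j|i|j]; first by rewrite mxE ler0n.
      rewrite (bigD1 i) //= mxE eqxx big1 ?addr0 // => j ji.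
      by rewrite mxE eq_sym (negPf ji).
    rewrite (bigD1 j) //= mxE eqxx big1 ?addr0 // => i ij.
    by rewrite mxE (negPf ij).
  have dsD l : doubly_stochastic (D l) by rewrite /D; case: ifP.
  apply: le_trans (kron_contract (tapp C3) dsD).
  rewrite le_eqVlt; apply/orP; left; apply/eqP; apply: eq_bigr => f _.
  rewrite kron_tapp; congr (_ ^+ 2); apply: eq_bigr => g _; congr (_ * _).
  apply: eq_bigr => l _; congr (fun_of_matrix _ _ _).
  rewrite /C2 /C3 /D /mix !inE.
  case: (eqVneq l p) => [->|lp].
    by rewrite andbF mul1mx eq_sym (negPf qp) pS.
  case: (eqVneq l q) => [->|lq] /=; first by rewrite mul1mx qS.
  by case: ifP => _; rewrite ?AP ?mul1mx.
have N f : `|tapp C1 f * tapp C2 f| <= (tapp C1 f ^+ 2 + tapp C2 f ^+ 2) / 2.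
  rewrite normrM -[tapp C1 f ^+ 2]real_normK ?num_real //.
  rewrite -[tapp C2 f ^+ 2]real_normK ?num_real //.
  have := sqr_ge0 (`|tapp C1 f| - `|tapp C2 f|); rewrite sqrrB; lra.
apply: le_trans (ler_norm_sum _ _ _) _.
apply: le_trans (ler_sum _ (fun f _ => N f)) _.
rewrite -mulr_suml big_split /= h1.
by rewrite ler_pdivrMr ?ltr0n // mulrDr mulr1 lerD2l.
Qed.

End Mix.

(** * Expansion around the flat matrix *)

Lemma prod_if_in (R : comNzRingType) (I : finType) (S : {set I}) (a b : R) :
  \prod_i (if i \in S then a else b) = a ^+ #|S| * b ^+ (#|I| - #|S|).
Proof.
rewrite (bigID (mem S)) /=; congr (_ * _).
  by rewrite -prodr_const; apply: eq_bigr => i ->.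
have -> : (#|I| - #|S|)%N = #|~: S| by rewrite [RHS]cardsCs setCK.
rewrite -prodr_const.
by apply: eq_big => i; rewrite ?inE // => /negPf ->.
Qed.

(** Expand over the set [S] of rows where the diagonal term is taken: the permutation must fix [S]
    pointwise, which leaves (n - |S|)! choices. *)
Lemma permanent_scalar_add_const (R : comNzRingType) (n : nat) (s b : R) :
  permanent (\matrix_(i < n, j < n) (s * (i == j)%:R + b)) =
  \sum_(k < n.+1) ('C(n, k) * (n - k)`!)%:R * (s ^+ k * b ^+ (n - k)).
Proof.
transitivity (\sum_(S : {set 'I_n})
    (n - #|S|)`!%:R * (s ^+ #|S| * b ^+ (n - #|S|))).
  rewrite /permanent; under eq_bigr => t _.
    under eq_bigr => i _ do rewrite mxE.
    rewrite (bigA_distr _ (GRing.add : R -> R -> R)) /=; over.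
  rewrite exchange_big /=; apply: eq_bigr => S _.
  have -> : s ^+ #|S| * b ^+ (n - #|S|) = \prod_i (if i \in S then s else b).
    by rewrite prod_if_in card_ord.
  have -> : (n - #|S|)%N = #|~: S| by rewrite [RHS]cardsCs setCK card_ord.
  rewrite -card_perm mulr_natl -sumr_const.
  rewrite [RHS]big_mkcond; apply: eq_bigr => t _; rewrite unfold_in.
  case: ifPn => [/subsetP h|/subsetPn[i]].
    apply: eq_bigr => i _; case: ifP => // iS.
    have [_|ti] := eqVneq i (t i); first by rewrite mulr1.
    by have := h i; rewrite inE eq_sym ti inE iS => /(_ isT).
  rewrite !inE negbK eq_sym => it iS.
  by rewrite (bigD1 i) //= iS (negPf it) mulr0 mul0r.
rewrite (partition_big (fun S : {set 'I_n} => inord #|S| : 'I_n.+1) predT) //=.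
apply: eq_bigr => k _; rewrite natrM -mulrA mulr_natl.
have -> : 'C(n, k) = #|[set S : {set 'I_n} | #|S| == k]|.
  by rewrite card_draws card_ord.
have Sn (S : {set 'I_n}) : (#|S| < n.+1)%N.
  by rewrite ltnS -[X in (_ <= X)%N]card_ord max_card.
rewrite -sumr_const; apply: eq_big => [S|S /eqP <-]; last first.
  by rewrite inordK.
by rewrite inE -(inj_eq val_inj) /= inordK.
Qed.

(** The source of [T_]: the matrix is s times the identity plus the constant (1-s)/n, and C(n,k)
    (n-k)! = n!/k!. *)
Lemma permanent_flat_id (R : numFieldType) (n : nat) (s : R) : (0 < n)%N ->
  permanent (flat_mx R n + s *: (1%:M - flat_mx R n)) = d_ R n * T_ n s.
Proof.
move=> n0; have nR : n%:R != 0 :> R by rewrite pnatr_eq0 -lt0n.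
rewrite (_ : _ + _ = \matrix_(i, j) (s * (i == j)%:R + (1 - s) / n%:R)).
  rewrite permanent_scalar_add_const /T_ mulr_sumr; apply: eq_bigr => k _.
  have kn : (k <= n)%N by rewrite -ltnS.
  have kR : k`!%:R != 0 :> R by rewrite pnatr_eq0 -lt0n fact_gt0.
  have -> : ('C(n, k) * (n - k)`!)%:R = n`!%:R / k`!%:R :> R.
    apply: (mulIf kR); rewrite divfK // -natrM -(bin_fact kn) -mulnA.
    by rewrite [((n - k)`! * _)%N]mulnC.
  have nE : n%:R ^+ n = n%:R ^+ (n - k) * n%:R ^+ k :> R.
    by rewrite -exprD subnK.
  rewrite /d_ !exprMn exprVn nE; field.
  by rewrite kR !expf_neq0.
by apply/matrixP => i j; rewrite !mxE; field.
Qed.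

Lemma permanent_flat (R : numFieldType) (n : nat) :
  permanent (flat_mx R n) = d_ R n.
Proof.
rewrite /permanent (eq_bigr (fun=> n%:R ^- n)).
  by rewrite sumr_const card_Sn -[LHS]mulr_natl.
move=> s _; under eq_bigr do rewrite mxE.
by rewrite prodr_const card_ord exprVn.
Qed.

Lemma tform_mix_expand (R : realFieldType) (m : nat) (Y : 'M[R]_m.+2) (a : R) :
  tform (fun=> flat_mx R m.+2 + a *: Y) =
  \sum_(S : {set 'I_m.+2}) a ^+ #|S| * tform (mix S Y).
Proof.
have kE f g : kron (fun=> flat_mx R m.+2 + a *: Y) f g =
    \sum_(S : {set 'I_m.+2}) a ^+ #|S| * kron (mix S Y) f g.
  rewrite /kron; under eq_bigr do rewrite mxE addrC.
  rewrite (bigA_distr _ (GRing.add : R -> R -> R)) /=; apply: eq_bigr => S _.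
  rewrite -[a ^+ _]mulr1.
  rewrite -[X in _ * X * _](expr1n _ (#|'I_m.+2| - #|S|)) -prod_if_in.
  rewrite -big_split; apply: eq_bigr => i _; rewrite /mix.
  by case: ifP => _ /=; rewrite ?mxE ?mul1r.
rewrite /tform /tapp.
under eq_bigr => f _.
  under eq_bigr => g _ do rewrite kE mulr_suml.
  rewrite exchange_big mulr_sumr /=; over.
rewrite exchange_big; apply: eq_bigr => S _; rewrite mulr_sumr.
apply: eq_bigr => f _; rewrite mulrCA; congr (_ * _); rewrite mulr_sumr.
by apply: eq_bigr => g _; rewrite mulrA.
Qed.

Lemma permanent_marcus_minc_le (R : realFieldType) (m : nat) (A : 'M[R]_m.+2) :
  doubly_stochastic A ->
  permanent (marcus_minc A) <= d_ R m.+2 * (1 + beta_ R m.+2 *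
    \sum_i \sum_j (A i j - m.+2%:R^-1) ^+ 2).
Proof.
move=> dsA; set r2 := \sum_i _.
pose X := A - flat_mx R m.+2; pose P : 'M[R]_m.+2 := 1%:M - flat_mx R m.+2.
pose s : R := m.+1%:R^-1.
have m1 : 0 < m.+1%:R :> R by rewrite ltr0n.
have n1 : m.+2%:R - 1 = m.+1%:R :> R by rewrite -natr1 addrK.
have F0 : 0 < m.+2`!%:R :> R by rewrite ltr0n fact_gt0.
have -> : marcus_minc A = flat_mx R m.+2 + - s *: X.
  apply/matrixP => i j; rewrite !mxE n1 /s -[m.+2%:R]natr1 -natr1; field.
  by rewrite !natr1 !pnatr_eq0.
have r2E : r2 = \sum_i \sum_j X i j ^+ 2.
  by apply: eq_bigr => i _; apply: eq_bigr => j _; rewrite !mxE.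
have expand Y a : m.+2`!%:R * permanent (flat_mx R m.+2 + a *: Y) =
    m.+2`!%:R * d_ R m.+2 +
    \sum_(S : {set 'I_m.+2} | S != set0) a ^+ #|S| * tform (mix S Y).
  rewrite -tform_const tform_mix_expand (bigD1 set0) //= cards0 mul1r.
  congr (_ + _); rewrite -permanent_flat -tform_const; apply: eq_tform => l.
  by rewrite /mix inE.
(* The signs of (-s)^|S| disappear under absolute values, so the comparison is term by term. *)
have le :
  \sum_(S : {set 'I_m.+2} | S != set0) (- s) ^+ #|S| * tform (mix S X) <=
    r2 / m.+1%:R *
    \sum_(S : {set 'I_m.+2} | S != set0) s ^+ #|S| * tform (mix S P).
  rewrite mulr_sumr; apply: ler_sum => S S0; apply: le_trans (ler_norm _) _.
  rewrite normrM normrX normrN [`|s|]gtr0_norm ?invr_gt0 // mulrCA.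
  rewrite ler_pM2l ?exprn_gt0 ?invr_gt0 // r2E.
  exact: tform_mix_le dsA (erefl X) S0.
(* The expansion at [P], read backwards, evaluates the sum of the majorants. *)
have PE : \sum_(S : {set 'I_m.+2} | S != set0) s ^+ #|S| * tform (mix S P) =
    m.+2`!%:R * d_ R m.+2 * (T_ m.+2 s - 1).
  apply: (addrI (m.+2`!%:R * d_ R m.+2)).
  by rewrite -expand permanent_flat_id //; ring.
rewrite -(ler_pM2l F0) expand; apply: le_trans (lerD (lexx _) le) _.
rewrite PE /beta_ n1 div1r -/s le_eqVlt; apply/orP; left; apply/eqP; ring.
Qed.

Theorem theorem1p2 (R : realType) (n : nat) (hn : (2 <= n)%N) (A : 'M[R]_n)
    (hA : doubly_stochastic A) :
  let r := frobenius_norm (A - flat_mx R n) in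
  permanent A / d_ R n >= expR (a_ R n * r ^+ 2) /\
  permanent (marcus_minc A) / d_ R n <= 1 + beta_ R n * r ^+ 2.
Proof.
case: n hn A hA => [|[|m]] // _ A hA r.
have rE : r ^+ 2 = \sum_i \sum_j (A i j - m.+2%:R^-1) ^+ 2.
  rewrite sqr_sqrtr.
    by apply: eq_bigr => i _; apply: eq_bigr => j _; rewrite !mxE.
  by rewrite sumr_ge0 // => i _; rewrite sumr_ge0 // => j _; rewrite sqr_ge0.
have d0 : 0 < d_ R m.+2 by rewrite divr_gt0 ?exprn_gt0 ?ltr0n ?fact_gt0.
rewrite rE ler_pdivlMr // ler_pdivrMr // mulrC.
rewrite [X in _ /\ is_true (_ <= X)]mulrC.
by split; [exact: permanent_ge|exact: permanent_marcus_minc_le].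
Qed.
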